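(* Let $g$ be a $\mathbb{Z}_2^2$-symmetric Lorentzian metric on $\mathbb{H}_3$ such that the (nontrivial) components of the corresponding grading of $\mathfrak{h}_3$ are non-degenerate. Then $g$ can be reduced, by an automorphism of $\mathfrak{h}_3$, to one of the two forms $$g=-\omega_1^2+\omega_2^2+\lambda^2\omega_3^2,\qquad g=\omega_1^2+\omega_2^2-\lambda^2\omega_3^2,$$ for some real $\lambda\neq 0$.
   Context: $\mathbb{H}_3$ is the Heisenberg group of real upper triangular unipotent $3\times3$ matrices. Its Lie algebra $\mathfrak{h}_3$ has basis $X_1,X_2,X_3$ with $[X_1,X_2]=X_3$, $[X_1,X_3]=[X_2,X_3]=0$; $\{\omega_1,\omega_2,\omega_3\}$ is the dual basis, also viewed as left-invariant 1-forms on $\mathbb{H}_3$. A Lorentzian metric on $\mathbb{H}_3$ here means a left-invariant one, i.e. it is given by a non-degenerate symmetric bilinear form $B$ on $\mathfrak{h}_3$ of signature $(2,1)$ (two positive, one negative). A $\mathbb{Z}_2^2$-symmetric structure on $\mathbb{H}_3$ is given by a $\mathbb{Z}_2^2$-grading $\mathfrak{h}_3=\bigoplus_{\gamma\in\mathbb{Z}_2^2}\mathfrak{g}_\gamma$, $[\mathfrak{g}_\gamma,\mathfrak{g}_{\gamma'}]\subset\mathfrak{g}_{\gamma\gamma'}$, with $\mathfrak{g}_e=\{0\}$ for the identity $e$ of $\mathbb{Z}_2^2$. The metric $g$ is called $\mathbb{Z}_2^2$-symmetric Lorentzian (with respect to such a structure) if one of the following holds: (1) the nontrivial components $\mathfrak{g}_\gamma$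 are orthogonal and non-degenerate with respect to $B$; (2) one nontrivial component $\mathfrak{g}_{\lambda_0}$ is degenerate, the other components are orthogonal and non-degenerate, and there exists a component $\mathfrak{g}_{\lambda_1}$ such that the restriction of $B$ to $\mathfrak{g}_{\lambda_0}\oplus\mathfrak{g}_{\lambda_1}$ has signature $(1,1)$. ''Reduced by an automorphism to a form'' means that the form is obtained from $B$ by pulling back along an automorphism of the Lie algebra $\mathfrak{h}_3$. *)

(* Defs.v *)
From HB Require Import structures.
From mathcomp Require Import all_boot all_order all_algebra.
From mathcomp Require Import reals ring.

Set Implicit Arguments.
Unset Strict Implicit.
Unset Printing Implicit Defensive.

Import Order.TTheory GRing.Theory Num.Theory.
Local Open Scope ring_scope.

(* The Heisenberg algebra, as coordinate vectors in the basis X1, X2, X3. *)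
Notation h3 R := 'rV[R]_3.

Section Heisenberg.
Variable R : realType.
Implicit Types u v : h3 R.

Definition X1 : h3 R := delta_mx 0 0.
Definition X2 : h3 R := delta_mx 0 1.
Definition X3 : h3 R := delta_mx 0 2.

Definition omega1 u : R := u 0 0.
Definition omega2 u : R := u 0 1.
Definition omega3 u : R := u 0 2.

Definition h3_bracket u v : h3 R :=
  (omega1 u * omega2 v - omega2 u * omega1 v) *: X3.

Lemma h3_bracketX12 : h3_bracket X1 X2 = X3.
Proof. by rewrite /h3_bracket /omega1 /omega2 !mxE /= mulr1 mulr0 subr0 scale1r. Qed.

Lemma h3_bracketX13 : h3_bracket X1 X3 = 0.
Proof. by rewrite /h3_bracket /omega1 /omega2 !mxE /= !mulr0 subr0 scale0r. Qed.

Lemma h3_bracketX23 : h3_bracket X2 X3 = 0.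
Proof. by rewrite /h3_bracket /omega1 /omega2 !mxE /= !mulr0 subr0 scale0r. Qed.

(* The identification of h3 with the strictly upper triangular 3 x 3 matrices,
   i.e. the Lie algebra of the group of unipotent upper triangular ones. *)
Definition h3_mx u : 'M[R]_3 :=
  omega1 u *: delta_mx 0 1 + omega2 u *: delta_mx 1 2 + omega3 u *: delta_mx 0 2.

Lemma h3_mx_bracket u v :
  h3_mx (h3_bracket u v) = h3_mx u *m h3_mx v - h3_mx v *m h3_mx u.
Proof.
apply/matrixP => i j; rewrite /h3_mx /h3_bracket /omega1 /omega2 /omega3.
rewrite !mxE !big_ord_recl !big_ord0 !mxE /=.
by case: i => [[|[|[|//]]] ?]; case: j => [[|[|[|//]]] ?]; rewrite /=; ring.
Qed.

Definition h3_automorphism (f : 'End(h3 R)) : Prop :=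
  lker f == 0%VS /\ forall u v, f (h3_bracket u v) = h3_bracket (f u) (f v).

(* The group Z_2^2 is written additively, with identity 0. *)
Definition Z22_grading (g : 'Z_2 * 'Z_2 -> {vspace h3 R}) : Prop :=
  [/\ (\sum_a g a)%VS = fullv, directv (\sum_a g a),
      forall a b u v, u \in g a -> v \in g b -> h3_bracket u v \in g (a + b)
    & g 0 = 0%VS].

End Heisenberg.

Section Forms.
Variables (R : realType) (vT : vectType R) (B : {symmetric vT}).
Implicit Types U V : {vspace vT}.

Definition orthogonal_spaces U V : Prop := (U <= orthov B V)%VS.

Definition nondegenerate_on V : Prop := (V :&: orthov B V)%VS = 0%VS.

(* The restriction of B to V is non-degenerate of signature (p, q), i.e. with
   p positive and q negative squares; then p + q = \dim V. *)
Definition has_signature V (p q : nat) : Prop :=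
  exists (s : p.-tuple vT) (t : q.-tuple vT),
    [/\ basis_of V (s ++ t), pairwise_orthogonal B (s ++ t),
        {in s, forall e, 0 < B e e} & {in t, forall e, B e e < 0}].

End Forms.

Section Metrics.
Variable R : realType.
Implicit Types (g : 'Z_2 * 'Z_2 -> {vspace h3 R}) (B : {symmetric h3 R}).

Definition lorentzian B : Prop := has_signature B fullv 2 1.

Definition Z22_symmetric_nondegenerate g B : Prop :=
  (forall a b, a != 0 -> b != 0 -> a != b -> orthogonal_spaces B (g a) (g b)) /\
  (forall a, a != 0 -> nondegenerate_on B (g a)).

(* The orthogonality condition only concerns the two components other than
   g l0 and g 0. *)
Definition Z22_symmetric_degenerate g B : Prop :=
  exists2 l0, l0 != 0 &
    [/\ ~ nondegenerate_on B (g l0),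
        forall a b, a != 0 -> b != 0 -> a != l0 -> b != l0 -> a != b ->
          orthogonal_spaces B (g a) (g b),
        forall a, a != 0 -> a != l0 -> nondegenerate_on B (g a)
      & exists l1, [/\ l1 != 0, l1 != l0 & has_signature B (g l0 + g l1) 1 1]].

Definition Z22_symmetric_lorentzian g B : Prop :=
  [/\ lorentzian B, Z22_grading g
    & Z22_symmetric_nondegenerate g B \/ Z22_symmetric_degenerate g B].

End Metrics.

(* Main.v *)
Require Import Defs.
From HB Require Import structures.
From mathcomp Require Import all_boot all_order all_algebra.
From mathcomp Require Import reals ring lra.

Set Implicit Arguments.
Unset Strict Implicit.
Unset Printing Implicit Defensive.

Import Order.TTheory GRing.Theory Num.Theory.
Local Open Scope ring_scope.

(** As [g_0 = 0], every component of the grading is abelian, and since [h3] is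
    not, two distinct nontrivial components contain [u] and [v] with
    [[u, v] <> 0].  The bracket lies in the third component, so
    [(u, v, [u, v])] is a [B]-orthogonal basis satisfying the structure
    equations of [h3] and diagonalizes [B] by an automorphism.  The signature
    forces exactly one of the three vectors to be timelike; rescaling [u] and
    [v], and exchanging them if necessary, gives the two normal forms. *)

(** * Forms of signature (2, 1) through a timelike axis *)

Section Lorentzian.
Variables (R : realType) (B : {symmetric h3 R}).
Implicit Types p q z e : h3 R.

Lemma symmC p q : B p q = B q p.
Proof. by rewrite hermC expr0 mul1r. Qed.

Lemma formDl p q z : B (p + q) z = B p z + B q z.
Proof. exact: linearDl. Qed.

Lemma formZl a p z : B (a *: p) z = a * B p z.
Proof. exact: linearZl_LR. Qed.

Lemma formDr p q z : B z (p + q) = B z p + B z q.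
Proof. exact: linearDr. Qed.

Lemma formZr a p z : B z (a *: p) = a * B z p.
Proof. exact: linearZr_LR. Qed.

Lemma formNr p z : B z (- p) = - B z p.
Proof. exact: linearNr. Qed.

Definition formE := (formDl, formDr, formZl, formZr).

(* A basis-free form of signature (2, 1): the orthogonal of some timelike
   vector is positive definite. *)
Definition timelike_axis e :=
  B e e < 0 /\ forall z, B z e = 0 -> z != 0 -> 0 < B z z.

(** The negative vector of an orthogonal basis serves: orthogonality to it kills its coordinate and
    leaves a positive combination of two squares. *)
Lemma lorentzian_timelike_axis : lorentzian B -> exists e, timelike_axis e.
Proof.
case=> [s [t [bst ost s_gt0 t_lt0]]].
case/tupleP: s bst ost s_gt0 => e1 s; case/tupleP: s => e2 s; rewrite (tuple0 s).
case/tupleP: t t_lt0 => e3 t; rewrite (tuple0 t) /= => t_lt0 bst ost s_gt0.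
have e1_gt0 : 0 < B e1 e1 by apply: s_gt0; rewrite !inE eqxx.
have e2_gt0 : 0 < B e2 e2 by apply: s_gt0; rewrite !inE eqxx orbT.
have e3_lt0 : B e3 e3 < 0 by apply: t_lt0; rewrite !inE eqxx.
move: ost; rewrite /pairwise_orthogonal /= !andbT => /andP[_].
move=> /andP[/andP[/eqP B12 /eqP B13] /eqP B23].
exists e3; split=> // z Bz3 z0.
have : z \in <<[:: e1; e2; e3]>>%VS by rewrite (span_basis bst) memvf.
rewrite !span_cons span_nil addv0 => /memv_addP[_ /vlineP[a ->]].
case=> _ /memv_addP[_ /vlineP[b ->] [_ /vlineP[c ->] ->]] zE.
move: Bz3 z0; rewrite {}zE !formE B13 B23 !mulr0 !add0r => /eqP.
rewrite mulf_eq0 (lt_eqF e3_lt0) orbF => /eqP ->.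
rewrite scale0r addr0 (symmC e2 e1) B12 !mul0r !mulr0 !addr0 !add0r => z0.
rewrite !mulrA -!expr2.
have [a0|a0] := eqVneq a 0.
  move: z0; rewrite a0 scale0r add0r scaler_eq0 negb_or => /andP[b0 _].
  by rewrite expr0n mul0r add0r mulr_gt0 // exprn_even_gt0.
apply: ltr_pwDl; first by rewrite mulr_gt0 // exprn_even_gt0.
by rewrite mulr_ge0 ?sqr_ge0 // ltW.
Qed.

Variable e : h3 R.
Hypothesis e_axis : timelike_axis e.

Lemma radical_eq0 z : (forall x, B z x = 0) -> z = 0.
Proof.
move=> Bz; apply/eqP/negPn/negP => /(e_axis.2 _ (Bz e)).
by rewrite Bz ltxx.
Qed.

(** The plane of [p] and [q] would be negative definite, yet it meets the orthogonal of [e], where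
    the form is positive; [z] is the combination lying in both. *)
Lemma no_orthogonal_timelike p q :
  B p q = 0 -> B p p < 0 -> B q q < 0 -> False.
Proof.
move=> Bpq p_lt0 q_lt0; set z := B q e *: p + (- B p e) *: q.
have Bze : B z e = 0 by rewrite !formE; ring.
have Bzp : B z p = B q e * B p p by rewrite !formE (symmC q p) Bpq; ring.
(* If [z] vanishes, pairing with [p] gives [B q e = 0], so [q] itself lies in the positive definite
   orthogonal of [e]. *)
have [z0|z0] := eqVneq z 0.
  have : B q e * B p p = 0 by rewrite -Bzp z0 linear0l.
  move/eqP; rewrite mulf_eq0 (lt_eqF p_lt0) orbF => /eqP Bqe.
  have q0 : q != 0.
    by apply/eqP => q0; move: q_lt0; rewrite q0 linear0l ltxx.
  by have := lt_trans (e_axis.2 _ Bqe q0) q_lt0; rewrite ltxx.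
have := e_axis.2 _ Bze z0.
by rewrite !formE (symmC q p) Bpq; nra.
Qed.

End Lorentzian.

(** * Automorphisms from pairs of non-commuting vectors *)

Section Frames.
Variable R : realType.
Implicit Types u v p q : h3 R.

Lemma h3_bracket_coordE u v :
  ((omega1 (h3_bracket u v) = 0) * (omega2 (h3_bracket u v) = 0) *
   (omega3 (h3_bracket u v) = omega1 u * omega2 v - omega2 u * omega1 v))%type.
Proof.
by rewrite /h3_bracket /omega1 /omega2 /omega3 /X3 !mxE /= !mulr0 mulr1.
Qed.

Lemma h3_bracketZ a b u v :
  h3_bracket (a *: u) (b *: v) = (a * b) *: h3_bracket u v.
Proof.
rewrite /h3_bracket /omega1 /omega2 !mxE scalerA; congr (_ *: _); ring.
Qed.

Lemma h3_bracketC u v : h3_bracket v u = - h3_bracket u v.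
Proof.
rewrite /h3_bracket -scaleNr; congr (_ *: _); ring.
Qed.

Lemma h3_bracket0l v : h3_bracket 0 v = 0.
Proof. by rewrite /h3_bracket /omega1 /omega2 !mxE !mul0r subrr scale0r. Qed.

Lemma h3_bracket0r u : h3_bracket u 0 = 0.
Proof. by rewrite h3_bracketC h3_bracket0l oppr0. Qed.

Lemma h3_bracket_suml (I : finType) (F : I -> h3 R) v :
  h3_bracket (\sum_i F i) v = \sum_i h3_bracket (F i) v.
Proof.
rewrite /h3_bracket -scaler_suml; congr (_ *: _).
by rewrite sumrB /omega1 /omega2 !summxE !mulr_suml.
Qed.

Lemma h3_bracket_sumr (I : finType) (F : I -> h3 R) u :
  h3_bracket u (\sum_i F i) = \sum_i h3_bracket u (F i).
Proof.
rewrite h3_bracketC h3_bracket_suml -sumrN; apply: eq_bigr => i _.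
by rewrite [RHS]h3_bracketC.
Qed.

Lemma h3_automorphism_surj (f : 'End(h3 R)) :
  h3_automorphism f -> forall v, exists u, v = f u.
Proof.
case=> f_inj _ v; have : v \in limg f by rewrite lker0_limgf // memvf.
by case/memv_imgP => u _ ->; exists u.
Qed.

(** A linear map with [X1], [X2], [X3] sent to [p], [q], [[p, q]] preserves brackets because
    [[p, q]] is central. It is injective because the determinant of [p] and [q] modulo the centre is
    the nonzero coefficient of [[p, q]] on [X3]. *)
Lemma h3_frame_automorphism p q : h3_bracket p q != 0 ->
  exists2 f : 'End(h3 R), h3_automorphism f &
    forall u, f u = omega1 u *: p + omega2 u *: q
                    + omega3 u *: h3_bracket p q.
Proof.
set w := h3_bracket p q => w0.
pose M : 'M[R]_3 := \matrix_(i < 3) nth 0 [:: p; q; w] i.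
pose f : 'End(h3 R) := linfun (mulmxr M).
have fE u : f u = omega1 u *: p + omega2 u *: q + omega3 u *: w.
  rewrite lfunE /= mulmx_sum_row !big_ord_recl big_ord0 addr0 !rowK /= addrA.
  by rewrite /omega1 /omega2 /omega3; do 2?congr (_ + _);
     congr (u _ _ *: _); apply: val_inj.
exists f => //; split; last first.
  move=> u v; rewrite fE !h3_bracket_coordE !scale0r !add0r.
  rewrite !fE /w /h3_bracket scalerA; congr (_ *: _).
  by rewrite /omega1 /omega2 /X3 !mxE /=; ring.
rewrite -subv0; apply/subvP => x; rewrite memv_ker memv0 fE => /eqP fx0.
have D0 : omega1 p * omega2 q - omega2 p * omega1 q != 0.
  by apply: contraNneq w0 => D0; rewrite /w /h3_bracket D0 scale0r.
have x1p : omega1 x * omega1 p + omega2 x * omega1 q = 0.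
  have := congr1 (@omega1 R) fx0; rewrite /w /h3_bracket /omega1 /X3 !mxE /=.
  by rewrite !mulr0 addr0.
have x2p : omega1 x * omega2 p + omega2 x * omega2 q = 0.
  have := congr1 (@omega2 R) fx0; rewrite /w /h3_bracket /omega2 /X3 !mxE /=.
  by rewrite !mulr0 addr0.
(* Cramer's rule for the system [x1p], [x2p], of determinant [D0]. *)
have x1 : omega1 x = 0.
  apply: (mulIf D0); rewrite mul0r.
  transitivity (omega2 q * (omega1 x * omega1 p + omega2 x * omega1 q)
                - omega1 q * (omega1 x * omega2 p + omega2 x * omega2 q)).
    by ring.
  by rewrite x1p x2p !mulr0 subrr.
have x2 : omega2 x = 0.
  apply: (mulIf D0); rewrite mul0r.
  transitivity (omega1 p * (omega1 x * omega2 p + omega2 x * omega2 q)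
                - omega2 p * (omega1 x * omega1 p + omega2 x * omega1 q)).
    by ring.
  by rewrite x1p x2p !mulr0 subrr.
move/eqP: fx0; rewrite x1 x2 !scale0r !add0r scaler_eq0 (negPf w0) orbF.
move=> /eqP x3; apply/eqP/rowP => -[[|[|[|//]]] i3]; rewrite mxE;
  [rewrite -x1|rewrite -x2|rewrite -x3]; congr (x _ _); exact: val_inj.
Qed.

End Frames.

(** * Signs and normalization of an orthogonal frame *)

Section NormalForm.
Variables (R : realType) (B : {symmetric h3 R}).
Implicit Types p q : h3 R.

(** The third vector of the frame is the bracket; its being nonzero makes the three vectors a
    basis. *)
Definition orthogonal_frame p q :=
  [/\ h3_bracket p q != 0, B p q = 0, B p (h3_bracket p q) = 0
    & B q (h3_bracket p q) = 0].

Lemma orthogonal_frameC p q : orthogonal_frame p q -> orthogonal_frame q p.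
Proof.
case=> w0 pq pw qw; split.
- by rewrite h3_bracketC oppr_eq0.
- by rewrite symmC.
- by rewrite h3_bracketC formNr qw oppr0.
- by rewrite h3_bracketC formNr pw oppr0.
Qed.

Lemma orthogonal_frameZ a b p q : a != 0 -> b != 0 ->
  orthogonal_frame p q -> orthogonal_frame (a *: p) (b *: q).
Proof.
move=> a0 b0 [w0 pq pw qw]; split.
- by rewrite h3_bracketZ scaler_eq0 mulf_eq0 !negb_or a0 b0.
- by rewrite formZl formZr pq !mulr0.
- by rewrite h3_bracketZ formZl formZr pw !mulr0.
- by rewrite h3_bracketZ formZl formZr qw !mulr0.
Qed.

Lemma orthogonal_frame_diagonalizes p q : orthogonal_frame p q ->
  exists2 f : 'End(h3 R), h3_automorphism f & forall u v, B (f u) (f v) =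
    B p p * (omega1 u * omega1 v) + B q q * (omega2 u * omega2 v)
    + B (h3_bracket p q) (h3_bracket p q) * (omega3 u * omega3 v).
Proof.
case=> w0; have [f f_aut fE] := h3_frame_automorphism w0.
move: (h3_bracket p q) fE => w fE pq pw qw.
exists f => // u v; rewrite !fE !formE (symmC B q p) (symmC B w p) (symmC B w q).
by rewrite pq pw qw; ring.
Qed.

Lemma normalize p : B p p != 0 ->
  exists2 a, a != 0 & B (a *: p) (a *: p) = Num.sg (B p p).
Proof.
move=> p0; exists (Num.sqrt `|B p p|)^-1.
  by rewrite invr_eq0 sqrtr_eq0 -ltNge normr_gt0.
rewrite !formE mulrA -expr2 exprVn sqr_sqrtr // {2}[B p p]numEsg mulrCA.
by rewrite mulVf ?mulr1 ?normr_eq0.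
Qed.

Variable e : h3 R.
Hypothesis e_axis : timelike_axis B e.

(** The frame spans, so an isotropic frame vector would lie in the radical; and three positive
    squares would make [B e e] nonnegative. *)
Lemma orthogonal_frame_signs p q (w := h3_bracket p q) :
  orthogonal_frame p q ->
  [/\ B p p != 0, B q q != 0, B w w != 0
    & ~ [/\ 0 < B p p, 0 < B q q & 0 < B w w]].
Proof.
move=> pqF; have [w0 pq pw qw] := pqF; rewrite -/w in w0 pw qw.
have [f /h3_automorphism_surj f_onto fE] := orthogonal_frame_diagonalizes pqF.
have [g /h3_automorphism_surj g_onto gE] := h3_frame_automorphism w0.
rewrite -/w in gE.
have nonisotropic z : z != 0 -> B z p = 0 -> B z q = 0 -> B z w = 0 -> False.
  move=> /eqP z0 zp zq zw; apply: z0; apply: (radical_eq0 e_axis) => x.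
  have [y ->] := g_onto x; rewrite gE; clearbody w.
  by rewrite !formE zp zq zw; ring.
have p0 : p != 0.
  by apply: contraNneq w0 => p0; rewrite /w p0 h3_bracket0l.
have q0 : q != 0.
  by apply: contraNneq w0 => q0; rewrite /w q0 h3_bracket0r.
split.
- by apply/eqP => pp; apply: (nonisotropic p).
- by apply/eqP => qq; apply: (nonisotropic q); rewrite // symmC.
- by apply/eqP => ww; apply: (nonisotropic w); rewrite // symmC.
case=> pp qq ww; have [x ex] := f_onto e.
have := e_axis.1; rewrite ex fE ltNge => /negP; apply.
by rewrite -!expr2 !addr_ge0 // mulr_ge0 ?sqr_ge0 // ltW.
Qed.

Lemma orthogonal_frame_normal_form p q : orthogonal_frame p q ->
  exists (f : 'End(h3 R)) (lambda : R),
    [/\ h3_automorphism f, lambda != 0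
      & (forall u v, B (f u) (f v) =
           - (omega1 u * omega1 v) + omega2 u * omega2 v
           + lambda ^+ 2 * (omega3 u * omega3 v)) \/
        (forall u v, B (f u) (f v) =
           omega1 u * omega1 v + omega2 u * omega2 v
           - lambda ^+ 2 * (omega3 u * omega3 v))].
Proof.
(* Two orthogonal vectors are not both timelike, so exchanging [p] and [q] if necessary makes [q]
   spacelike. *)
wlog q_gt0 : p q / 0 < B q q.
  move=> IH pqF; have [p0 q0 _ _] := orthogonal_frame_signs pqF.
  have [q_gt0|q_le0] := ltP 0 (B q q); first exact: IH pqF.
  have [p_gt0|p_le0] := ltP 0 (B p p).
    exact: IH p_gt0 (orthogonal_frameC pqF).
  have [_ pq _ _] := pqF.
  by case: (no_orthogonal_timelike e_axis pq); rewrite lt_neqAle ?p0 ?q0.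
move=> pqF; have [p0 q0 _ _] := orthogonal_frame_signs pqF.
have [a a0 aE] := normalize p0; have [b b0 bE] := normalize q0.
have F := orthogonal_frameZ a0 b0 pqF.
move: bE; rewrite gtr0_sg // => qq1.
move: (a *: p) (b *: q) F aE qq1 => p' q' F pp qq.
have [f f_aut fE] := orthogonal_frame_diagonalizes F.
have [_ _ w0 not_pos] := orthogonal_frame_signs F.
set w := h3_bracket p' q' in w0 not_pos fE.
(* Here [w] is the bracket of the rescaled vectors, so [lambda] absorbs the scaling forced on the
   third vector. *)
exists f, (Num.sqrt `|B w w|).
have l2 : Num.sqrt `|B w w| ^+ 2 = `|B w w| by rewrite sqr_sqrtr.
split=> //; first by rewrite sqrtr_eq0 -ltNge normr_gt0.
(* The sign of [B p p] selects the form: if positive, [w] must be the timelike vector; if negative,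
   [w] is orthogonal to a timelike vector and cannot be timelike. *)
rewrite l2; have [p_gt0|p_le0] := ltP 0 (B p p).
  right=> u v; move: pp; rewrite fE gtr0_sg // qq => pp.
  have w_le0 : B w w <= 0.
    by rewrite leNgt; apply/negP => w_gt0; apply: not_pos; rewrite pp qq ltr01.
  by rewrite pp ler0_norm // !mul1r mulNr opprK.
left=> u v; have p_lt0 : B p p < 0 by rewrite lt_neqAle p0.
move: pp; rewrite fE ltr0_sg // qq => pp.
have w_ge0 : 0 <= B w w.
  rewrite leNgt; apply/negP => w_lt0; have [_ _ pw _] := F.
  by apply: (no_orthogonal_timelike e_axis pw); rewrite // pp ltrN10.
by rewrite pp ger0_norm // mulN1r mul1r.
Qed.

End NormalForm.

(** * An orthogonal frame from the grading *)

(** Expand [X1] and [X2] along the grading: if all brackets of their components vanished, so would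
    [[X1, X2] = X3]. *)
Lemma Z22_grading_noncommuting (R : realType)
    (g : 'Z_2 * 'Z_2 -> {vspace h3 R}) : Z22_grading g ->
  exists a b p q, [/\ p \in g a, q \in g b & h3_bracket p q != 0].
Proof.
case=> g_full _ _ _.
have /memv_sumP[x xg X1E] : X1 R \in (\sum_a g a)%VS by rewrite g_full memvf.
have /memv_sumP[y yg X2E] : X2 R \in (\sum_a g a)%VS by rewrite g_full memvf.
have [/existsP[a /existsP[b ab]]|/existsPn comm] :=
    boolP [exists a, exists b, h3_bracket (x a) (y b) != 0].
  by exists a, b, (x a), (y b); split; [exact: xg | exact: yg |].
have := h3_bracketX12 R; rewrite X1E X2E h3_bracket_suml big1 => [|a _].
  move/esym/rowP/(_ 2); rewrite /X3 !mxE /= => /eqP.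
  by rewrite oner_eq0.
rewrite h3_bracket_sumr big1 // => b _.
by apply/eqP/negPn; have /existsPn/(_ b) := comm a.
Qed.

Theorem proposition5p2 (R : realType) (g : 'Z_2 * 'Z_2 -> {vspace h3 R})
    (B : {symmetric h3 R}) :
  Z22_symmetric_lorentzian g B ->
  (forall a, a != 0 -> nondegenerate_on B (g a)) ->
  exists (f : 'End(h3 R)) (lambda : R),
    [/\ h3_automorphism f, lambda != 0
      & (forall u v, B (f u) (f v) =
           - (omega1 u * omega1 v) + omega2 u * omega2 v
           + lambda ^+ 2 * (omega3 u * omega3 v)) \/
        (forall u v, B (f u) (f v) =
           omega1 u * omega1 v + omega2 u * omega2 v
           - lambda ^+ 2 * (omega3 u * omega3 v))].
Proof.
case=> /lorentzian_timelike_axis[e e_axis] gG [[orth _]|] nondeg; last first.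
  by case: nondeg => l0 l0_neq0 [ndeg_l0 _ _ _] /(_ l0 l0_neq0).
have [a [b [p [q [pa qb w0]]]]] := Z22_grading_noncommuting gG.
have [_ _ g_bracket g0] := gG.
have in_g0 z : z \in g 0 -> z = 0 by rewrite g0 memv0 => /eqP.
have wab := g_bracket a b p q pa qb.
(* Since [g 0 = 0], the nonzero vectors [p], [q], [[p, q]] force [a], [b], [a + b] to be nonzero. *)
have nz c z : z \in g c -> z != 0 -> c != 0.
  by move=> zc; apply: contraNneq => c0; apply/eqP/in_g0; rewrite -c0.
have p0 : p != 0.
  by apply: contraNneq w0 => ->; rewrite h3_bracket0l.
have q0 : q != 0.
  by apply: contraNneq w0 => ->; rewrite h3_bracket0r.
have a0 := nz _ _ pa p0; have b0 := nz _ _ qb q0; have ab0 := nz _ _ wab w0.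
(* As the group has exponent 2, [a + b != 0] means [a != b]; the three indices are then pairwise
   distinct and their components mutually orthogonal. *)
have addcc (c : 'Z_2 * 'Z_2) : c + c = 0.
  by case: c => -[[|[|//]] ?] [[|[|//]] ?]; congr (_, _); apply: val_inj.
have ab : a != b by apply: contraNneq ab0 => ->; rewrite addcc.
have a_ab : a != a + b by rewrite -[X in X != _]addr0 (inj_eq (addrI a)) eq_sym.
have b_ab : b != a + b by rewrite -[X in X != _]add0r (inj_eq (addIr b)) eq_sym.
apply: (orthogonal_frame_normal_form e_axis (p := p) (q := q)); split=> //.
- exact: (orthovP (orth a b a0 b0 ab)).
- exact: (orthovP (orth a _ a0 ab0 a_ab)).
- exact: (orthovP (orth b _ b0 ab0 b_ab)).
Qed.
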